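(* The following facet-defining inequality of $\mathrm{BQP}_6$, $$\begin{aligned}&2-2x_1-x_2+x_3-2x_4+3x_5-x_6+2X_{12}-X_{13}-X_{23}+2X_{14}+X_{24}\\&\quad-2X_{15}-X_{25}-X_{45}+X_{16}+X_{36}+X_{46}-X_{56}\ \ge 0,\end{aligned}$$ cannot be represented as an Eigen-CG inequality; that is, there are no $(v_0,v)\in\mathbb{R}\times\mathbb{R}^6$ and $\lambda>0$ such that $\lambda\cdot\mathrm{E\text{-}CG}(v_0,v)$ equals the coefficient vector of this inequality (variables $X_{ij}$ not displayed have coefficient $0$, and the constant term is $2$).
   Context: $\mathrm{BQP}_n=\operatorname{conv}\{(x,X)\in\{0,1\}^{n+\binom n2}: X_{i,j}=x_ix_j,\ 1\le i<j\le n\}$ (Boolean quadric polytope). The paper takes the displayed inequality as a known facet of $\mathrm{BQP}_6$, obtained by exhaustive enumeration; the content of the claim is the non-representability. For $v_0\in\mathbb{R}$, $v\in\mathbb{R}^n$, $\mathrm{E\text{-}CG}(v_0,v)=(\alpha,\beta,\gamma)\in\mathbb{R}^{n+\binom n2+1}$ with $\alpha_i=\lceil v_i^2+2v_iv_0\rceil$ for $i\in\{1,\dots,n\}$, $\beta_{ij}=\lceil 2v_iv_j\rceil$ for $1\le i<j\le n$, $\gamma=\lfloor v_0^2\rfloor$; it is the coefficient vector of the Eigen-CG inequality $\sum_{i<j}\beta_{ij}X_{ij}+\sum_i\alpha_ix_i+\gamma\ge0$. An inequality written in the form $\sum_{i<j}b_{ij}X_{ij}+\sum_ia_ix_i+c\ge0$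 has coefficient vector $(a,b,c)$. *)

(* Defs.v *)
From HB Require Import structures.
From mathcomp Require Import all_boot all_order all_algebra.
From mathcomp Require Import ring.
From mathcomp Require Import classical_sets reals convex.

Set Implicit Arguments.
Unset Strict Implicit.
Unset Printing Implicit Defensive.

Import Order.TTheory GRing.Theory Num.Theory.
Local Open Scope classical_set_scope.
Local Open Scope ring_scope.

(* Pairs i < j; indices of 'I_n are 0-based, so the pair (i, j) stands for
   X_{i+1,j+1}. *)
Notation upair n := {p : 'I_n * 'I_n | (p.1 < p.2)%N}.

(* Points (x, X) of R^(n + C(n,2)). *)
Notation point R n := ('rV[R]_n * {ffun upair n -> R^o})%type.

(* Coefficient vectors (a, b, c) in R^(n + C(n,2) + 1). *)
Notation coefs R n := (point R n * R^o)%type.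

Definition convex_hull (R : realType) (V : lmodType R) (A : set V) : set V :=
  smallest (fun C : set V => convex_set C) A.

Definition BQP (R : realType) (n : nat) : set (point R n) :=
  convex_hull [set z : point R n |
    [/\ forall i, z.1 0 i = 0 \/ z.1 0 i = 1,
        forall p, z.2 p = 0 \/ z.2 p = 1 &
        forall p, z.2 p = z.1 0 (val p).1 * z.1 0 (val p).2]].

Definition lhs (R : realType) (n : nat) (c : coefs R n) (z : point R n) : R :=
  \sum_p c.1.2 p * z.2 p + \sum_i c.1.1 0 i * z.1 0 i + c.2.

Definition affinely_independent (R : realType) (V : lmodType R) (k : nat)
    (p : 'I_k -> V) : Prop :=
  forall t : 'I_k -> R,
    \sum_i t i = 0 -> \sum_i t i *: p i = 0 -> forall i, t i = 0.

(* The largest affinely independent family in A has k points, i.e. the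
   dimension of A is k - 1 (so that the empty set has dimension -1). *)
Definition affine_rank (R : realType) (V : lmodType R) (A : set V) (k : nat)
    : Prop :=
  (exists p : 'I_k -> V, (forall i, A (p i)) /\ affinely_independent p) /\
  ~ (exists p : 'I_k.+1 -> V, (forall i, A (p i)) /\ affinely_independent p).

(* The inequality lhs c z >= 0 is valid on P and the face of P on which it is
   tight has dimension dim P - 1. *)
Definition facet_defining (R : realType) (n : nat) (P : set (point R n))
    (c : coefs R n) : Prop :=
  (forall z, P z -> 0 <= lhs c z) /\
  exists k, affine_rank (P `&` [set z | lhs c z = 0]) k /\ affine_rank P k.+1.

Definition E_CG (R : realType) (n : nat) (v0 : R) (v : 'rV[R]_n) : coefs R n :=
  (\row_i (Num.ceil (v 0 i ^+ 2 + 2 * v 0 i * v0))%:~R,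
   [ffun p : upair n => (Num.ceil (2 * v 0 (val p).1 * v 0 (val p).2))%:~R],
   (Num.floor (v0 ^+ 2))%:~R).

(* The inequality of lhs_bqp6_coefs; row i, column j of the table is the
   coefficient of X_ij. *)
Definition bqp6_coefs (R : realType) : coefs R 6 :=
  let b : seq (seq R) :=
    [:: [:: 0;  2; -1;  2; -2;  1];
        [:: 0;  0; -1;  1; -1;  0];
        [:: 0;  0;  0;  0;  0;  1];
        [:: 0;  0;  0;  0; -1;  1];
        [:: 0;  0;  0;  0;  0; -1];
        [:: 0;  0;  0;  0;  0;  0]] in
  (\row_(i < 6) [:: -2; -1; 1; -2; 3; -1]`_i,
   [ffun p : upair 6 => (nth [::] b (val p).1)`_(val p).2 : R^o],
   2).

Lemma sum_upair (R : realType) (n : nat) (F : 'I_n -> 'I_n -> R) :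
  \sum_(p : upair n) F (val p).1 (val p).2 =
  \sum_(i < n) \sum_(j < n | (i < j)%N) F i j.
Proof.
rewrite pair_big_dep /= (reindex_omap (val : upair n -> _) insub) /=; last first.
  by move=> p ltp; rewrite insubT.
by apply: eq_bigl => p; rewrite (valP p) valK eqxx.
Qed.

(* x i and X i j are the 1-based variables x_i and X_ij. *)
Lemma lhs_bqp6_coefs (R : realType) (x : nat -> R) (X : nat -> nat -> R) :
  lhs (bqp6_coefs R)
    (\row_i x i.+1, [ffun p : upair 6 => X (val p).1.+1 (val p).2.+1 : R^o]) =
  2 - 2 * x 1 - x 2 + x 3 - 2 * x 4 + 3 * x 5 - x 6
    + 2 * X 1 2 - X 1 3 - X 2 3 + 2 * X 1 4 + X 2 4
    - 2 * X 1 5 - X 2 5 - X 4 5 + X 1 6 + X 3 6 + X 4 6 - X 5 6.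
Proof.
rewrite /lhs /=.
under eq_bigr do rewrite !ffunE.
under [X in _ + X + _]eq_bigr do rewrite !mxE.
rewrite (sum_upair (fun i j : 'I_6 => (nth [::] _ i)`_j * X i.+1 j.+1)).
by do ! rewrite ?(big_mkcond (fun _ => ltn _ _)) ?big_ord_recl ?big_ord0 /=; ring.
Qed.

(* Main.v *)
Require Import Defs.
From mathcomp Require Import all_boot all_order all_algebra.
From mathcomp Require Import classical_sets reals.
From mathcomp Require Import ring lra interval_inference convex.

(** Non-representability is a matter of signs.  If a ceiling is positive then so
    is its argument, and if it is negative then so is its argument; scaling by
    lambda > 0 preserves both.  The coefficients +1, +1, -1 of X_16, X_36, X_13
    would therefore give v_1 v_6 > 0, v_3 v_6 > 0 and v_1 v_3 < 0, whereas
    (v_1 v_3) v_6^2 = (v_1 v_6)(v_3 v_6).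

    That the inequality defines a facet rests on its 21 = 6 + C(6,2) tight
    vertices.  Once these are known to be affinely independent, both dimensions
    follow ([facet_defining_of_independent]): any vertex off the hyperplane
    raises the affine rank to 22, which is the maximum in a space of dimension
    21, so the face cannot itself reach 22.

    Affine independence ([affinely_independent_vertices]) uses the fact that the
    coordinates of a vertex (x, X) are all the monomials of degree at most 2 in
    the 0/1 vector x, so an affine dependence between vertices is a signed
    weight t on 0/1 vectors that annihilates every quadratic function
    ([sum_quad_value]).  If a quadratic function is nonzero at one vertex and
    zero at all the vertices that still carry weight, that vertex has weight
    zero.  Repeating this with the products of two affine forms listed in
    [tight_cert] removes the 21 vertices one after the other. *)

Set Implicit Arguments.
Unset Strict Implicit.
Unset Printing Implicit Defensive.

Import Order.TTheory GRing.Theory Num.Theory VectorInternalTheory.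
Local Open Scope classical_set_scope.
Local Open Scope ring_scope.

(** * Affine independence and facets *)

(** Prefixing the coordinates of each point with a 1 turns affine dependences
    into linear ones, in a space of dimension one more. *)
Lemma affinely_independent_card (R : realType) (V : vectType R) (k : nat)
    (p : 'I_k -> V) :
  affinely_independent p -> (k <= (dim V).+1)%N.
Proof.
move=> indep; rewrite leqNgt; apply/negP => ltVk.
pose M := row_mx (const_mx 1 : 'cV[R]_k) (\matrix_i v2r (p i)).
have /rowV0Pn[u /sub_kermxP uM0 /eqP[]] : kermx M != 0.
  rewrite kermx_eq0 /row_free neq_ltn.
  by rewrite (leq_ltn_trans (rank_leq_col M)).
move: uM0; rewrite mul_mx_row -row_mx0 => /eq_row_mx[u1 up].
apply/rowP => i; rewrite [RHS]mxE; apply: indep.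
  move/rowP/(_ 0): u1; rewrite !mxE => u1; rewrite -[RHS]u1.
  by apply: eq_bigr => j _; rewrite !mxE mulr1.
apply: (can_inj v2rK); rewrite linear0 linear_sum -[RHS]up mulmx_sum_row.
by apply: eq_bigr => j _; rewrite rowK linearZ.
Qed.

Lemma card_upair n : #|{: upair n}| = 'C(n, 2).
Proof.
rewrite card_sig -sum1_card.
rewrite -(pair_big_dep xpredT (fun i j : 'I_n => (i < j)%N) (fun _ _ => 1%N)) /=.
rewrite (exchange_big_dep xpredT) //= -bin2_sum big_mkord; apply: eq_bigr => j _.
rewrite (eq_bigl (fun i : 'I_n => (i < j)%N)) //.
rewrite -(big_ord_widen n (fun=> 1%N)) ?sum1_card ?card_ord //.
exact: ltnW.
Qed.

Lemma dim_point (R : realType) n :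
  dim (Defs.point R n : vectType R) = (n + 'C(n, 2))%N.
Proof.
rewrite -card_upair; congr (_ + _)%N; first exact: mul1n.
exact: muln1.
Qed.


Section AffineFunction.
Variables (R : realType) (n : nat) (c : coefs R n).

Lemma lhs_affine_dependence k (t : 'I_k -> R) (p : 'I_k -> Defs.point R n) :
  \sum_i t i = 0 -> \sum_i t i *: p i = 0 -> \sum_i t i * lhs c (p i) = 0.
Proof.
pose l z := lhs (c.1, 0) z.
have lhsE z : lhs c z = l z + c.2 by rewrite /l /lhs /= addr0.
have lD : {morph l : u v / u + v}.
  move=> u v; rewrite /l /lhs /= !addr0 addrACA -!big_split /=.
  by congr (_ + _); apply: eq_bigr => i _; rewrite ?ffunE ?mxE mulrDr.
have lZ a u : l (a *: u) = a * l u.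
  rewrite /l /lhs /= !addr0 mulrDr !mulr_sumr.
  by congr (_ + _); apply: eq_bigr => i _; rewrite ?ffunE ?mxE mulrCA.
have l0 : l 0 = 0 by rewrite -(scale0r 0) lZ mul0r.
move=> t0 tp0; under eq_bigr => i _ do rewrite lhsE mulrDr -lZ.
by rewrite big_split /= -mulr_suml t0 mul0r addr0 -(big_morph l lD l0) tp0 l0.
Qed.

(** Evaluating the affine function at a dependence leaves only the weight of the
    point z outside the hyperplane, which therefore vanishes. *)
Lemma affinely_independent_off_hyperplane k (p : 'I_k -> Defs.point R n) z :
  affinely_independent p -> (forall i, lhs c (p i) = 0) -> lhs c z != 0 ->
  affinely_independent (fun i : 'I_k.+1 => oapp p z (unlift ord0 i)).
Proof.
move=> indep p0 z0 t t0 tp0.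
have tz : t ord0 = 0.
  move: (lhs_affine_dependence t0 tp0).
  rewrite big_ord_recl unlift_none /= big1 => [|i _].
    by rewrite addr0 => /eqP; rewrite mulf_eq0 (negPf z0) orbF => /eqP.
  by rewrite liftK /= p0 mulr0.
move: t0 tp0; rewrite !big_ord_recl tz scale0r !add0r => t0 tp0 i.
have [j ->|->] := unliftP ord0 i => //.
apply: (indep (t \o lift ord0)) => //=; rewrite -[RHS]tp0.
by apply: eq_bigr => k' _; rewrite liftK.
Qed.

(** A point off the hyperplane serves twice: it extends the family p to one that
    is maximal in the whole space, and it would extend any larger family in the
    face beyond that maximum. *)
Lemma facet_defining_of_independent (P : set (Defs.point R n))
    (p : 'I_(n + 'C(n, 2)) -> Defs.point R n) (z : Defs.point R n) :
  (forall y, P y -> 0 <= lhs c y) ->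
  affinely_independent p -> (forall i, P (p i)) ->
  (forall i, lhs c (p i) = 0) -> P z -> lhs c z != 0 ->
  facet_defining P c.
Proof.
move=> valid indep Pp p0 Pz z0; split => //.
exists (n + 'C(n, 2))%N; split; split.
- by exists p; split => // i; split; [exact: Pp | exact: p0].
- case=> q [Fq qindep].
  have := affinely_independent_off_hyperplane qindep (fun i => (Fq i).2) z0.
  move/(@affinely_independent_card R (Defs.point R n : vectType R)).
  by rewrite dim_point ltnn.
- exists (fun i => oapp p z (unlift ord0 i)); split.
    by move=> i; case: (unlift ord0 i).
  exact: affinely_independent_off_hyperplane.
- case=> q [_ /(@affinely_independent_card R (Defs.point R n : vectType R))].
  by rewrite dim_point ltnn.
Qed.

Lemma lhs_ge0_convex : convex_set ([set z | 0 <= lhs c z] : set (Defs.point R n)).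
Proof.
move=> x y k; rewrite !inE /= => x0 y0.
have -> : lhs c (conv k x y) = k%:num * lhs c x + (1 - k%:num) * lhs c y.
  (* Weights k, 1 - k, -1 on x, y and their barycenter are an affine dependence. *)
  pose t (i : 'I_3) : R := [:: k%:num; 1 - k%:num; -1]`_i.
  pose p (i : 'I_3) : Defs.point R n := [:: x; y; conv k x y]`_i.
  apply/esym/eqP; rewrite -subr_eq0; apply/eqP.
  rewrite -[RHS](@lhs_affine_dependence _ t p) !big_ord_recl big_ord0 /t /p /=.
  - by rewrite mulN1r addr0 addrA.
  - by rewrite addr0 addrA subrKC subrr.
  - by rewrite addr0 scaleN1r addrA subrr.
by rewrite addr_ge0 // mulr_ge0 // subr_ge0.
Qed.

End AffineFunction.

(** * Vertices of the Boolean quadric polytope and quadratic functions *)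

(** The default value of [nth] lets x be shorter than n: missing entries are 0. *)
Definition vertex (R : realType) (n : nat) (x : seq bool) : Defs.point R n :=
  (\row_i (nth false x i)%:R,
   [ffun p : upair n => (nth false x (val p).1 && nth false x (val p).2)%:R]).

Lemma BQP_vertex (R : realType) (n : nat) (x : seq bool) :
  BQP (vertex R n x).
Proof.
apply: sub_gen_smallest; split=> [i|p|p]; rewrite ?mxE ?ffunE /=.
- by case: nth; [right | left].
- by case: (_ && _); [right | left].
- by rewrite -natrM mulnb.
Qed.

Lemma lhs_ge0_on_BQP (R : realType) (n : nat) (c : coefs R n) :
  (forall x, 0 <= lhs c (vertex R n x)) -> forall z, BQP z -> 0 <= lhs c z.
Proof.
move=> vertex_ge0 z /(_ [set z | 0 <= lhs c z]); apply; split.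
  exact: lhs_ge0_convex.
move=> y [y01 _ yM] /=.
suff -> : y = vertex R n [seq y.1 0 i == 1 | i : 'I_n] by [].
have nthE (i : 'I_n) : (nth false [seq y.1 0 i == 1 | i : 'I_n] i)%:R = y.1 0 i.
  rewrite (nth_map i) ?size_enum_ord // nth_ord_enum.
  by case: (y01 i) => ->; rewrite ?eqxx // eq_sym oner_eq0.
rewrite [LHS]surjective_pairing; congr (_, _).
  by apply/rowP => i; rewrite mxE nthE.
by apply/ffunP => p; rewrite ffunE -mulnb natrM !nthE yM.
Qed.

(** The affine form l_0 + l_1 x_1 + ... + l_n x_n: consing true onto x makes it
    homogeneous, and shifts the entries of x to their usual 1-based numbering. *)
Definition affine_value (n : nat) (l : seq int) (x : seq bool) : int :=
  \sum_(0 <= i < n.+1) l`_i * (nth false (true :: x) i)%:Z.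

Definition quad_value (n : nat) (q : seq int * seq int) (x : seq bool) : int :=
  affine_value n q.1 x * affine_value n q.2 x.

(** Linear coordinates of vertices supply the moments of degree 1, quadratic
    coordinates those of degree 2; squares reduce to degree 1 because the x_i
    are 0 or 1, and the vanishing of the sum of the weights is degree 0. *)
Lemma sum_quad_value (R : realType) (n k : nat) (t : 'I_k -> R)
    (x : 'I_k -> seq bool) (q : seq int * seq int) :
  \sum_j t j = 0 -> \sum_j t j *: vertex R n (x j) = 0 ->
  \sum_j t j * (quad_value n q (x j))%:~R = 0.
Proof.
move=> t0 tp0; pose y j i := nth false (true :: x j) i.
(* y j i is the homogenized coordinate, so y j 0 is the constant 1. *)
have deg1 i : (i < n)%N -> \sum_j t j * (nth false (x j) i)%:R = 0.
  move=> ltin; have := congr1 (fun z : Defs.point R n => z.1 0 (Ordinal ltin)) tp0.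
  rewrite (big_morph (fun z : Defs.point R n => z.1 0 (Ordinal ltin))
    (id1 := 0) (op1 := +%R)) /= ?mxE //.
    by under eq_bigr => j _ do rewrite !mxE.
  by move=> u v; rewrite mxE.
have deg2 i i' : (i < i' < n)%N ->
    \sum_j t j * (nth false (x j) i && nth false (x j) i')%:R = 0.
  case/andP=> lt_ii' lt_i'n; have lt_in := ltn_trans lt_ii' lt_i'n.
  pose p : upair n := Sub (Ordinal lt_in, Ordinal lt_i'n) lt_ii'.
  have := congr1 (fun z : Defs.point R n => z.2 p) tp0.
  rewrite (big_morph (fun z : Defs.point R n => z.2 p)
    (id1 := 0) (op1 := +%R)) /= ?ffunE //.
    by under eq_bigr => j _ do rewrite !ffunE.
  by move=> u v; rewrite ffunE.
have y_le i i' : (i <= i')%N -> (i' < n.+1)%N ->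
    \sum_j t j * (y j i && y j i')%:R = 0.
  rewrite leq_eqVlt => /predU1P[<-|].
    under eq_bigr => j _ do rewrite andbb.
    case: i => [|i] ltin; last exact: deg1.
    by under eq_bigr => j _ do rewrite mulr1.
  case: i i' => [|i] [|i'] // lt_ii' lti'n; first exact: deg1.
  by apply: deg2; rewrite -ltnS lt_ii'.
have moment i i' : (i < n.+1)%N -> (i' < n.+1)%N ->
    \sum_j t j * (y j i && y j i')%:R = 0.
  case: (leqP i i') => [le_ii' _|/ltnW le_i'i + _]; first exact: y_le.
  by under eq_bigr => j _ do rewrite andbC; exact: y_le.
transitivity (\sum_(0 <= i < n.+1) \sum_(0 <= i' < n.+1)
    (q.1`_i * q.2`_i')%:~R * \sum_j t j * (y j i && y j i')%:R).
  under [RHS]eq_bigr => i _ do under eq_bigr => i' _ do rewrite mulr_sumr.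
  under [RHS]eq_bigr => i _ do rewrite exchange_big /=.
  rewrite [RHS]exchange_big /=; apply: eq_bigr => j _.
  rewrite /quad_value /affine_value mulr_suml rmorph_sum mulr_sumr /=.
  apply: eq_bigr => i _; rewrite mulr_sumr rmorph_sum mulr_sumr /=.
  by apply: eq_bigr => i' _; rewrite -mulnb natrM !rmorphM /= -/(y j _); ring.
rewrite big_nat big1 // => i /andP[_ ltin]; rewrite big_nat big1 // => i'.
by case/andP=> _ lti'n; rewrite moment // mulr0.
Qed.

(** The matrix of values of the quadratic functions at the vertices is triangular
    with nonzero diagonal, so the weights vanish one by one, in the order of s. *)
Lemma affinely_independent_vertices (R : realType) (n : nat)
    (s : seq (seq bool * (seq int * seq int))) (k : nat) :
  size s = k ->
  all (fun c => quad_value n c.2 c.1 != 0) s ->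
  pairwise (fun c d => quad_value n c.2 d.1 == 0) s ->
  affinely_independent (fun j : 'I_k => vertex R n (nth [::] (unzip1 s) j)).
Proof.
pose x0 : seq bool * (seq int * seq int) := ([::], ([::], [::])).
move=> <- /(all_nthP x0) diag /(pairwiseP x0) upper t t0 tp0.
suff ind m (j : 'I_(size s)) : (j < m)%N -> t j = 0 by move=> j; apply: (ind j.+1).
elim: m j => // m IHm j; rewrite ltnS => lejm.
have := sum_quad_value (nth x0 s j).2 t0 tp0.
rewrite (bigD1 j) //= big1 => [|i ne_ij].
  rewrite addr0 (nth_map x0) // => /eqP.
  by rewrite mulf_eq0 intr_eq0 (negPf (diag _ _)) ?orbF // => /eqP.
rewrite (nth_map x0) //.
have [lt_ij|lt_ji|eq_ij] := ltngtP i j.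
- by rewrite IHm ?mul0r // (leq_trans lt_ij).
- by rewrite (eqP (upper j i _ _ lt_ji)) ?mulr0 // inE.
- by rewrite (val_inj eq_ij) eqxx in ne_ij.
Qed.

(** * The tight vertices of the inequality *)

Lemma lhs_bqp6_vertex (R : realType) (x1 x2 x3 x4 x5 x6 : bool) :
  lhs (bqp6_coefs R) (vertex R 6 [:: x1; x2; x3; x4; x5; x6]) =
  2 - 2 * x1%:R - x2%:R + x3%:R - 2 * x4%:R + 3 * x5%:R - x6%:R
    + 2 * (x1 && x2)%:R - (x1 && x3)%:R - (x2 && x3)%:R + 2 * (x1 && x4)%:R
    + (x2 && x4)%:R - 2 * (x1 && x5)%:R - (x2 && x5)%:R - (x4 && x5)%:R
    + (x1 && x6)%:R + (x3 && x6)%:R + (x4 && x6)%:R - (x5 && x6)%:R.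
Proof.
pose x i := nth false [:: x1; x2; x3; x4; x5; x6] i.-1.
exact: (lhs_bqp6_coefs (fun i => (x i)%:R) (fun i j => (x i && x j)%:R)).
Qed.

Lemma vertex_nth (R : realType) (n : nat) (x : seq bool) :
  vertex R n x = vertex R n (mkseq (nth false x) n).
Proof.
congr (_, _); first by apply/rowP => i; rewrite !mxE nth_mkseq.
by apply/ffunP => p; rewrite !ffunE !nth_mkseq.
Qed.

Lemma bqp6_valid (R : realType) (x : seq bool) :
  0 <= lhs (bqp6_coefs R) (vertex R 6 x).
Proof.
rewrite vertex_nth lhs_bqp6_vertex.
by do 6![case: nth]; rewrite /=; lra.
Qed.

(** The affine forms 1, x_i and 1 - x_i, with i counted from 1. *)
Definition unit_form : seq int := [:: 1].
Definition coord (i : nat) : seq int := ncons i 0 [:: 1].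
Definition cocoord (i : nat) : seq int := 1 :: ncons i.-1 0 [:: -1].

(** The tight vertices, given by their supports, in an order such that the
    product of the two affine forms attached to each of them is nonzero there
    but zero at all the vertices further down.  The forms x_5 - x_1 and
    x_5 - x_3 occur because products of two literals do not suffice: after the
    first four vertices, every such product that is nonzero somewhere is
    nonzero at two of the remaining ones. *)
Definition tight_cert : seq (seq nat * (seq int * seq int)) :=
  [:: ([:: 1; 2; 3; 5; 6], (coord 3, coord 6));
      ([:: 2; 3; 4], (cocoord 1, coord 3));
      ([:: 2; 4; 5; 6], (cocoord 1, coord 5));
      ([:: 2; 6], (cocoord 1, cocoord 4));
      ([:: 1; 2; 3], (coord 2, [:: 0; -1; 0; 0; 0; 1]));
      ([:: 1; 2; 5; 6], (coord 2, [:: 0; 0; 0; -1; 0; 1]));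
      ([:: 2; 4; 6], (coord 2, coord 6));
      ([:: 1; 2; 3; 5], (coord 2, cocoord 4));
      ([:: 1; 2; 3; 4; 5], (coord 1, coord 2));
      ([:: 2; 4], (unit_form, coord 2));
      ([:: 1; 3; 4; 5], (coord 3, coord 5));
      ([:: 1; 3; 4], (coord 3, coord 4));
      ([:: 1; 3], (unit_form, coord 3));
      ([:: 1; 4; 5], (coord 5, cocoord 6));
      ([:: 1; 4; 5; 6], (coord 4, coord 5));
      ([:: 1; 5; 6], (unit_form, coord 5));
      ([:: 1; 4], (coord 1, coord 4));
      ([:: 1; 6], (coord 1, coord 6));
      ([:: 1], (unit_form, coord 1));
      ([:: 4; 6], (unit_form, coord 6));
      ([:: 4], (unit_form, unit_form))].

Definition bits (S : seq nat) : seq bool := [seq i \in S | i <- iota 1 6].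

Definition tight_bits_cert : seq (seq bool * (seq int * seq int)) :=
  [seq (bits c.1, c.2) | c <- tight_cert].

Lemma bqp6_tight (R : realType) (x : seq bool) :
  x \in unzip1 tight_bits_cert -> lhs (bqp6_coefs R) (vertex R 6 x) = 0.
Proof.
rewrite !inE; do 20![case/predU1P=> [->|]; first by rewrite lhs_bqp6_vertex /=; ring].
by move/eqP->; rewrite lhs_bqp6_vertex /=; ring.
Qed.

(** * The facet and its non-representability *)

Lemma bqp6_facet (R : realType) :
  facet_defining (@BQP R 6) (bqp6_coefs R).
Proof.
apply: (@facet_defining_of_independent _ _ _ _
  (fun j => vertex R 6 (nth [::] (unzip1 tight_bits_cert) j)) (vertex R 6 [::])).
- exact/lhs_ge0_on_BQP/bqp6_valid.
- apply: affinely_independent_vertices => //;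
    by rewrite /quad_value /affine_value unlock; vm_compute.
- by move=> j; exact: BQP_vertex.
- by move=> j; apply/bqp6_tight/mem_nth.
- exact: BQP_vertex.
- rewrite vertex_nth lhs_bqp6_vertex /=.
  by apply: lt0r_neq0; lra.
Qed.

Lemma E_CG_pair_sign (R : realType) (n : nat) (v0 : R) (v : 'rV[R]_n)
    (lambda : R) (c : coefs R n) (p : upair n) :
  0 < lambda -> lambda *: E_CG v0 v = c ->
  (0 < c.1.2 p -> 0 < v 0 (val p).1 * v 0 (val p).2) /\
  (c.1.2 p < 0 -> v 0 (val p).1 * v 0 (val p).2 < 0).
Proof.
move=> lambda_gt0 <-.
have -> : (lambda *: E_CG v0 v).1.2 p =
    lambda * (Num.ceil (2 * (v 0 (val p).1 * v 0 (val p).2)))%:~R.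
  by rewrite /= !ffunE mulrA.
rewrite (pmulr_rgt0 _ lambda_gt0) (pmulr_rlt0 _ lambda_gt0) ltr0z ltrz0.
rewrite ceil_gt0 ceil_lt0 pmulr_rgt0 ?ltr0n //; split=> // le_N1.
by rewrite -(pmulr_rlt0 _ (ltr0n R 2)) (le_lt_trans le_N1) ?oppr_lt0.
Qed.

Theorem proposition3 (R : realType) :
  facet_defining (@BQP R 6) (bqp6_coefs R) /\
  ~ (exists (v0 : R) (v : 'rV[R]_6) (lambda : R),
       0 < lambda /\ lambda *: E_CG v0 v = bqp6_coefs R).
Proof.
split; first exact: bqp6_facet.
case=> v0 [v [lambda [lambda_gt0 eqc]]].
pose i1 : 'I_6 := Ordinal (isT : (0 < 6)%N).
pose i3 : 'I_6 := Ordinal (isT : (2 < 6)%N).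
pose i6 : 'I_6 := Ordinal (isT : (5 < 6)%N).
pose p13 : upair 6 := Sub (i1, i3) isT.
pose p16 : upair 6 := Sub (i1, i6) isT.
pose p36 : upair 6 := Sub (i3, i6) isT.
have [_ v13_lt0] := E_CG_pair_sign p13 lambda_gt0 eqc.
have [v16_gt0 _] := E_CG_pair_sign p16 lambda_gt0 eqc.
have [v36_gt0 _] := E_CG_pair_sign p36 lambda_gt0 eqc.
have {}v13_lt0 : v 0 i1 * v 0 i3 < 0 by apply: v13_lt0; rewrite /= ffunE /= oppr_lt0.
have {}v16_gt0 : 0 < v 0 i1 * v 0 i6 by apply: v16_gt0; rewrite /= ffunE /=.
have {}v36_gt0 : 0 < v 0 i3 * v 0 i6 by apply: v36_gt0; rewrite /= ffunE /=.
suff : 0 <= (v 0 i1 * v 0 i3) * v 0 i6 ^+ 2.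
  rewrite nmulr_rge0 // => v6_le0.
  have : v 0 i6 = 0 by apply/eqP; rewrite -sqrf_eq0 eq_le v6_le0 sqr_ge0.
  by move=> v6_0; rewrite v6_0 mulr0 ltxx in v16_gt0.
by rewrite expr2 mulrACA; apply/ltW/mulr_gt0.
Qed.
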